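(* Let $\mathcal U$ be an ultrafilter defined on a set $\mathcal I$, let $X_i$, $i\in\mathcal I$, be a collection of real Banach spaces and let $X$ be the corresponding ultraproduct of the $X_i$. Then the following assertions are equivalent: (1) $X$ has the Daugavet property. (2) For every $\varepsilon>0$, $\lim_{\mathcal U,n}\mathrm{Daug}_n(X_i,\varepsilon)=0$. In other words, for every fixed $\varepsilon>0$ and every $\delta>0$ there is an $n\in\mathbb{N}$ such that the set of all $i\in\mathcal I$ for which $\mathrm{Daug}_n(X_i,\varepsilon)<\delta$ belongs to the ultrafilter $\mathcal U$.
   Context: All Banach spaces are real; $S(X)$ is the unit sphere of $X$. A Banach space $X$ has the Daugavet property if $\|\mathrm{Id}+T\|=1+\|T\|$ for every bounded rank-$1$ linear operator $T: X\to X$. The ultraproduct of $(X_i)$ along $\mathcal U$ is the quotient of the space of bounded families $(x_i)$, $x_i\in X_i$, by the subspace of families with $\lim_{\mathcal U}\|x_i\|=0$, with norm $\|(x_i)\|=\lim_{\mathcal U}\|x_i\|$. For a Banach space $X$, $x\in S(X)$ and $\varepsilon>0$ put $l^+(x,\varepsilon)=\{y\in X: \|y\|\le 1+\varepsilon,\ \|x+y\|>2-\varepsilon\}$. For $A\subset X$, $\mathrm{conv}_n(A)$ is the set of all convex combinations of all $n$-point collections of elements of $A$. Define $\mathrm{Daug}_n(X,\varepsilon)=\sup_{x,y\in S(X)}\mathrm{dist}\bigl(y,\mathrm{conv}_n(l^+(x,\varepsilon))\bigr)$.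
   Formalization: The ultrafilter is assumed countably incomplete (free, if the index set is countable); for other ultrafilters, e.g. principal ones, (1) does not imply (2), by the Kadets–Werner space with the Daugavet property whose ultrapower lacks it. *)

(* Defs.v *)
From HB Require Import structures.
From mathcomp Require Import all_boot all_order all_algebra.
From mathcomp Require Import all_classical all_reals all_analysis.

Set Implicit Arguments.
Unset Strict Implicit.
Unset Printing Implicit Defensive.

Import Order.TTheory GRing.Theory Num.Theory.
Import numFieldNormedType.Exports.

Local Open Scope classical_set_scope.
Local Open Scope ring_scope.

Section Daugavet.
Context {R : realType}.

Definition unit_sphere (X : normedModType R) : set X := [set x | `|x| = 1].
Arguments unit_sphere : clear implicits.

Definition opnorm (X Y : normedModType R) (f : X -> Y) : \bar R :=
  ereal_sup [set (`|f x|)%:E | x in [set x : X | `|x| <= 1]].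

Definition rank_one (X Y : normedModType R) (f : X -> Y) : Prop :=
  exists2 v : Y, v != 0 & range f = [set a *: v | a in [set: R]].

Definition daugavet_property (X : normedModType R) : Prop :=
  forall T : {linear X -> X}, bounded_fun_norm T -> rank_one T ->
    opnorm (fun x : X => x + T x) = (1 + opnorm T)%E.

Definition lplus (X : normedModType R) (x : X) (eps : R) : set X :=
  [set y | `|y| <= 1 + eps /\ 2 - eps < `|x + y|].

(* The [n] points are allowed to repeat, and [conv_n 0 A] is empty. *)
Definition conv_n (X : normedModType R) (n : nat) (A : set X) : set X :=
  [set z | exists (a : 'I_n -> X) (t : 'I_n -> R),
     [/\ forall k, A (a k), forall k, 0 <= t k,
         \sum_(k < n) t k = 1 & z = \sum_(k < n) t k *: a k]].

(* Extended-real valued; it is [-oo] when [X] is the zero space, whose unit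
   sphere is empty. *)
Definition Daug (n : nat) (X : normedModType R) (eps : R) : \bar R :=
  ereal_sup [set edist_inf (conv_n n (lplus x eps)) y
            | x in unit_sphere X & y in unit_sphere X].

End Daugavet.

Arguments unit_sphere {R} X.

(* On a countable index set this says that [U] is free.  Without it the
   equivalence of the Daugavet property of the ultraproduct with the vanishing
   of the iterated limit of [Daug] fails: for the principal ultrafilter at [i] the
   ultraproduct is [X i], and Kadets and Werner (A Banach space with the Schur
   and the Daugavet property, Proc. AMS 132, 2004) exhibit a space with the
   Daugavet property for which [Daug n] does not tend to [0] as [n] grows. *)
Definition countably_incomplete (I : Type) (U : set_system I) : Prop :=
  exists A : nat -> set I, (forall n, U (A n)) /\ ~ U (\bigcap_n A n).

Section BoundedFamilies.
Context {R : realType} {I : Type} (X : I -> completeNormedModType R).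

Record bounded_family := BoundedFamily {
  family_of :> forall i, X i;
  family_bounded : exists M : R, forall i, `|family_of i| <= M }.

HB.instance Definition _ := gen_eqMixin bounded_family.
HB.instance Definition _ := gen_choiceMixin bounded_family.

Implicit Types x y z : bounded_family.

Lemma bounded_familyP x y : (forall i, x i = y i) -> x = y.
Proof.
case: x y => [x bx] [y Hy] /= xy.
have E : x = y by apply: functional_extensionality_dep.
by subst y; rewrite (Prop_irrelevance bx Hy).
Qed.

Let zero_bounded : exists M : R, forall i, `|0 : X i| <= M.
Proof. by exists 0 => i; rewrite normr0. Qed.

Let opp_bounded x : exists M : R, forall i, `|- x i| <= M.
Proof.
by have [M xM] := family_bounded x; exists M => i; rewrite normrN.
Qed.

Let add_bounded x y : exists M : R, forall i, `|x i + y i| <= M.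
Proof.
have [M xM] := family_bounded x; have [N yN] := family_bounded y.
by exists (M + N) => i; rewrite (le_trans (ler_normD _ _)) ?lerD.
Qed.

Let scale_bounded (a : R) x : exists M : R, forall i, `|a *: x i| <= M.
Proof.
have [M xM] := family_bounded x.
by exists (`|a| * M) => i; rewrite normrZ; apply: ler_wpM2l => //; apply: xM.
Qed.

Let zerof := BoundedFamily zero_bounded.
Let oppf x := BoundedFamily (opp_bounded x).
Let addf x y := BoundedFamily (add_bounded x y).
Let scalef a x := BoundedFamily (scale_bounded a x).

Let addfA : associative addf.
Proof. by move=> x y z; apply: bounded_familyP => i /=; rewrite addrA. Qed.
Let addfC : commutative addf.
Proof. by move=> x y; apply: bounded_familyP => i /=; rewrite addrC. Qed.
Let add0f : left_id zerof addf.
Proof. by move=> x; apply: bounded_familyP => i /=; rewrite add0r. Qed.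
Let addNf : left_inverse zerof oppf addf.
Proof. by move=> x; apply: bounded_familyP => i /=; rewrite addNr. Qed.

HB.instance Definition _ :=
  GRing.isZmodule.Build bounded_family addfA addfC add0f addNf.

Let scalefA a b x : scalef a (scalef b x) = scalef (a * b) x.
Proof. by apply: bounded_familyP => i /=; rewrite scalerA. Qed.
Let scale1f : left_id 1 scalef.
Proof. by move=> x; apply: bounded_familyP => i /=; rewrite scale1r. Qed.
Let scalefDr : right_distributive scalef +%R.
Proof. by move=> a x y; apply: bounded_familyP => i /=; rewrite scalerDr. Qed.
Let scalefDl x : {morph scalef^~ x : a b / a + b}.
Proof. by move=> a b; apply: bounded_familyP => i /=; rewrite scalerDl. Qed.

HB.instance Definition _ := GRing.Zmodule_isLmodule.Build R bounded_family
  scalefA scale1f scalefDr scalefDl.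

End BoundedFamilies.

Section Ultraproduct.
Context {R : realType} {I : Type} (U : set_system I) {FU : UltraFilter U}.
Context (X : I -> completeNormedModType R).
Local Notation family := (bounded_family X).
Implicit Types x y z : family.

Definition null_family : {pred family} :=
  fun x => `[< (fun i => `|x i|) @ U --> (0 : R) >].

Lemma null_familyP x :
  reflect ((fun i => `|x i|) @ U --> (0 : R)) (x \in null_family).
Proof. exact: asboolP. Qed.

Lemma null_family_submod : subsemimod_closed null_family.
Proof.
split; first split.
- by apply/null_familyP; under eq_fun do rewrite normr0; exact: cvg_cst.
- move=> x y /null_familyP x0 /null_familyP y0; apply/null_familyP.
  apply: (@squeeze_cvgr _ _ _ _ (fun=> 0) (fun i => `|x i| + `|y i|)); last 1 first.
  + by rewrite -[0]addr0; exact: cvgD.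
  + by near=> i; rewrite normr_ge0 ler_normD.
  + exact: cvg_cst.
- move=> a x /null_familyP x0; apply/null_familyP.
  under eq_fun do rewrite normrZ.
  by rewrite -[0](mulr0 `|a|); exact: cvgMl_tmp.
Unshelve. all: by end_near. Qed.

HB.instance Definition _ :=
  GRing.isSubmodClosed.Build R family null_family null_family_submod.

Definition ultraproduct : Type := Quotient.quot null_family.

HB.instance Definition _ := GRing.Zmodule.on ultraproduct.

Definition ultraproduct_pi : family -> ultraproduct :=
  \pi_(Quotient.quot null_family)%qT.

Let ultra_repr : ultraproduct -> family := @repr _ (Quotient.quot null_family).

Let ultra_reprK q : ultraproduct_pi (ultra_repr q) = q.
Proof. exact: reprK. Qed.

Lemma ultraproduct_pi_surj (q : ultraproduct) : exists x, ultraproduct_pi x = q.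
Proof. by exists (ultra_repr q); exact: ultra_reprK. Qed.

Lemma ultraproduct_piP x y : ultraproduct_pi x = ultraproduct_pi y <->
  (fun i => `|x i - y i|) @ U --> (0 : R).
Proof.
rewrite /ultraproduct_pi; split=> [/eqP|xy0].
  by rewrite -Quotient.idealrBE => /null_familyP.
by apply/eqP; rewrite -Quotient.idealrBE; apply/null_familyP.
Qed.

Lemma ultraproduct_piD x y :
  ultraproduct_pi (x + y) = ultraproduct_pi x + ultraproduct_pi y.
Proof. exact: (Quotient.pi_add null_family x y). Qed.

Let scaleq (a : R) (q : ultraproduct) : ultraproduct :=
  ultraproduct_pi (a *: ultra_repr q).

Let scaleq_pi a x : scaleq a (ultraproduct_pi x) = ultraproduct_pi (a *: x).
Proof.
apply/ultraproduct_piP.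
have /ultraproduct_piP := ultra_reprK (ultraproduct_pi x).
set y := ultra_repr _ => yx0.
rewrite (_ : (fun i => _) = fun i => `|a| * `|y i - x i|); last first.
  by apply/funext => i; rewrite -normrZ scalerBr.
by rewrite -[0](mulr0 `|a|); exact: cvgMl_tmp.
Qed.

Let scaleqA a b q : scaleq a (scaleq b q) = scaleq (a * b) q.
Proof.
by have [x <-] := ultraproduct_pi_surj q; rewrite !scaleq_pi scalerA.
Qed.
Let scale1q : left_id 1 scaleq.
Proof.
by move=> q; have [x <-] := ultraproduct_pi_surj q; rewrite scaleq_pi scale1r.
Qed.
Let scaleqDr : right_distributive scaleq +%R.
Proof.
move=> a p q; have [x <-] := ultraproduct_pi_surj p.
have [y <-] := ultraproduct_pi_surj q.
by rewrite -ultraproduct_piD !scaleq_pi -ultraproduct_piD scalerDr.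
Qed.
Let scaleqDl q : {morph scaleq^~ q : a b / a + b}.
Proof.
move=> a b; have [x <-] := ultraproduct_pi_surj q.
by rewrite !scaleq_pi -ultraproduct_piD scalerDl.
Qed.

HB.instance Definition _ := GRing.Zmodule_isLmodule.Build R ultraproduct
  scaleqA scale1q scaleqDr scaleqDl.

Lemma ultraproduct_piZ a x :
  ultraproduct_pi (a *: x) = a *: ultraproduct_pi x.
Proof. exact/esym/scaleq_pi. Qed.

Lemma ultra_bounded_cvg (f : I -> R) (M : R) :
  (forall i, `|f i| <= M) -> cvg (f @ U).
Proof.
move=> fM; have fUM : (f @ U) [set` `[- M, M]].
  by apply: nearW => i; rewrite /= in_itv /= -ler_norml; exact: fM.
have [p [_ pcl]] := @segment_compact R (- M) M (f @ U) _ fUM.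
apply/cvg_ex; exists p => A pA.
have [//|UnA] := in_ultra_setVsetC (f @^-1` A) FU.
by have [r []] := pcl (~` A) A UnA pA.
Qed.

Lemma family_norm_cvg x : cvg ((fun i => `|x i|) @ U).
Proof.
have [M xM] := family_bounded x.
by apply: (@ultra_bounded_cvg _ M) => i; rewrite normr_id; exact: xM.
Qed.

Let normq (q : ultraproduct) : R := lim ((fun i => `|ultra_repr q i|) @ U).

Let normq_pi x : normq (ultraproduct_pi x) = lim ((fun i => `|x i|) @ U).
Proof.
have /ultraproduct_piP := ultra_reprK (ultraproduct_pi x).
set y := ultra_repr _ => yx0; apply/cvg_lim => //.
rewrite -[lim _]addr0.
have -> : (fun i => `|y i|) = (fun i => `|x i|) \+ (fun i => `|y i| - `|x i|).
  by apply/funext => i /=; rewrite addrC subrK.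
apply: cvgD; first exact: family_norm_cvg.
apply/cvgr0Pnorm_lt => e e0; move/cvgr0Pnorm_lt : yx0 => /(_ e e0).
apply: filterS => i; rewrite normr_id; apply: le_lt_trans.
exact: ler_dist_dist.
Qed.

Let normqD p q : normq (p + q) <= normq p + normq q.
Proof.
have [x <-] := ultraproduct_pi_surj p; have [y <-] := ultraproduct_pi_surj q.
rewrite -ultraproduct_piD !normq_pi.
have nD := cvgB (cvgD (@family_norm_cvg x) (@family_norm_cvg y))
  (@family_norm_cvg (x + y)).
rewrite -subr_ge0; apply: (cvgr_to_ge (nD _ _)).
by apply: nearW => i; rewrite subr_ge0; exact: ler_normD.
Qed.

Let normqZ a q : normq (a *: q) = `|a| * normq q.
Proof.
have [x <-] := ultraproduct_pi_surj q.
rewrite -ultraproduct_piZ !normq_pi; apply/cvg_lim => //.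
under eq_fun do rewrite normrZ.
by apply: cvgMl_tmp; exact: family_norm_cvg.
Qed.

Let normq0_eq0 q : normq q = 0 -> q = 0.
Proof.
have [x <-] := ultraproduct_pi_surj q; rewrite normq_pi => x0.
have <- : ultraproduct_pi (0 *: x) = 0 by rewrite ultraproduct_piZ scale0r.
apply/ultraproduct_piP; rewrite (_ : (fun i => _) = fun i => `|x i|).
  by rewrite -x0; exact: family_norm_cvg.
by apply/funext => i; rewrite scale0r subr0.
Qed.

HB.instance Definition _ :=
  Lmodule_isNormed.Build R ultraproduct normqD normqZ normq0_eq0.

Lemma ultraproduct_norm x :
  `|ultraproduct_pi x| = lim ((fun i => `|x i|) @ U).
Proof. exact: normq_pi. Qed.

End Ultraproduct.

Arguments null_family {R I} U X.
Arguments ultraproduct {R I} U {FU} X.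
Arguments ultraproduct_pi {R I} U {FU X} x.

(* Main.v *)
Require Import Defs.
From HB Require Import structures.
From mathcomp Require Import all_boot all_order all_algebra.
From mathcomp Require Import all_classical all_reals all_analysis.
From mathcomp Require Import lra.

(** The Daugavet property of a space [X] says that every point [y] of the unit
    sphere is a limit of convex combinations of elements of [lplus x eps], for all
    [x] of the unit sphere and all [eps > 0]; the modulus [Daug n X eps] asks for
    combinations of [n] elements, with a uniform error.

    That characterization comes from the rank one operators [f(.) x]. If [y] is
    far from the convex hull of [lplus x eps], the Hahn-Banach theorem gives a
    functional [f] that is larger at [y] than on [lplus x eps], whereas the
    Daugavet equation for [f(.) x] forces [f] to be almost its norm at some element
    of [lplus x eps] ([daugavet_conv_lplus]). Conversely, if [y] almost norms [f]
    and is almost an average of elements of [lplus x eps], one of these elements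
    almost norms [f] too, and the Daugavet equation can be read off there
    ([conv_lplus_daugavet]). The Hahn-Banach theorem is obtained from the fact that
    a minimal sublinear functional is linear ([linear_minorant]).

    If [Daug n (X i) eps] is small for [U]-many [i] with one [n], the convex
    combinations of length [n] in the [X i] have a limit in the ultraproduct, as
    their coefficients converge along [U] ([conv_n_ultraproduct]). Otherwise no [n]
    works, and countable incompleteness gives a length [N i] that tends to infinity
    along [U] while [Daug (N i) (X i) eps] stays away from [0]
    ([countably_incomplete_diagonal]). The points [x i], [y i] that witness this
    define points of the ultraproduct for which the characterization fails: a
    convex combination of [n] elements near [y] would, at [U]-many [i], give one
    near [y i] of length [n <= N i]. *)

Set Implicit Arguments.
Unset Strict Implicit.
Unset Printing Implicit Defensive.

Import Order.TTheory GRing.Theory Num.Theory.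
Import numFieldNormedType.Exports.

Local Open Scope classical_set_scope.
Local Open Scope ring_scope.

(** * Sublinear functionals and linear minorants *)

Section Sublinear.
Context {R : realType} {V : lmodType R}.
Implicit Types (p q : V -> R) (u v w : V).

Definition sublinear p :=
  (forall u v, p (u + v) <= p u + p v) /\
  (forall (a : R) u, 0 <= a -> p (a *: u) = a * p u).

(** The converse of the last inequality is the same one for the inverse scalar. *)
Lemma sublinearI p : (forall u v, p (u + v) <= p u + p v) -> p 0 <= 0 ->
  (forall (a : R) u, 0 < a -> p (a *: u) <= a * p u) -> sublinear p.
Proof.
move=> pD p0 pZ; split=> // a u; rewrite le_eqVlt => /predU1P[<-|a0].
  rewrite scale0r mul0r; apply/eqP; rewrite eq_le p0 /=.
  by have := pD 0 0; rewrite addr0; lra.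
apply/eqP; rewrite eq_le pZ//=.
have := pZ a^-1 (a *: u); rewrite invr_gt0 scalerA mulVf ?gt_eqF// scale1r.
by move=> /(_ a0); rewrite mulrC ler_pdivlMr// mulrC.
Qed.

Section SublinearTheory.
Variables (p : V -> R) (p_sub : sublinear p).

Lemma sublinearD u v : p (u + v) <= p u + p v. Proof. exact: p_sub.1. Qed.

Lemma sublinearZ (a : R) u : 0 <= a -> p (a *: u) = a * p u.
Proof. exact: p_sub.2. Qed.

Lemma sublinear0 : p 0 = 0.
Proof. by rewrite -(scale0r 0) sublinearZ// mul0r. Qed.

Lemma sublinearN u : - p (- u) <= p u.
Proof. by have := sublinearD u (- u); rewrite subrr sublinear0; lra. Qed.

(** Lowering [p] along a convex cone of pairs [(w, c)] with [c <= p w] keeps it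
    sublinear, and the linear functionals below the result are those below [p] that
    are at least [c] at [w] for all these pairs. *)
Definition lowered (K : set (V * R)) u := inf [set p (u + k.1) - k.2 | k in K].

Section Lowered.
Variable K : set (V * R).
Hypothesis K0 : K (0, 0).
Hypothesis KD : forall k l, K k -> K l -> K (k.1 + l.1, k.2 + l.2).
Hypothesis KZ : forall (a : R) k, 0 < a -> K k -> K (a *: k.1, a * k.2).
Hypothesis Kp : forall k, K k -> k.2 <= p k.1.

Let lowered_lbound u : has_lbound [set p (u + k.1) - k.2 | k in K].
Proof.
exists (- p (- u)) => _ [k Kk <-]; have := Kp Kk.
by have := sublinearD (u + k.1) (- u); rewrite addrAC subrr add0r; lra.
Qed.

Lemma lowered_le u k : K k -> lowered K u <= p (u + k.1) - k.2.
Proof. by move=> Kk; apply: ge_inf; [exact: lowered_lbound|exists k]. Qed.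

Let lowered_adherent u (e : R) : 0 < e ->
  exists2 k, K k & p (u + k.1) - k.2 < lowered K u + e.
Proof.
move=> e0.
have [|_ [k Kk <-] ke] := @inf_adherent _ _ _ e0 (conj _ (lowered_lbound u)).
  by exists (p (u + 0) - 0), (0, 0).
by exists k.
Qed.

Lemma lowered_sublinear : sublinear (lowered K).
Proof.
apply: sublinearI => [u v||a u a0].
- apply/ler_addgt0Pr => e e0; have e2 : 0 < e / 2 by lra.
  have [k Kk ke] := lowered_adherent u e2; have [l Kl le] := lowered_adherent v e2.
  have /= := lowered_le (u + v) (KD Kk Kl).
  by have := sublinearD (u + k.1) (v + l.1); rewrite addrACA; lra.
- by have /= := lowered_le 0 K0; rewrite addr0 sublinear0 subr0.
- rewrite -ler_pdivrMl//; apply/ler_addgt0Pr => e e0.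
  have [k Kk ke] := lowered_adherent u e0.
  have /= := lowered_le (a *: u) (KZ a0 Kk).
  rewrite -scalerDr (sublinearZ _ (ltW a0)) -mulrBr => le.
  by rewrite ler_pdivrMl//; apply: (le_trans le); rewrite ler_pM2l// ltW.
Qed.

End Lowered.
End SublinearTheory.

(** Zorn's lemma: a chain of sublinear functionals below [p] is bounded from
    below by its pointwise infimum, which is sublinear because two members of
    the chain that are nearly optimal at two points have a common lower bound in
    the chain. *)
Lemma minimal_sublinear p : sublinear p ->
  exists q, [/\ sublinear q, forall u, q u <= p u &
    forall r, sublinear r -> (forall u, r u <= q u) -> r = q].
Proof.
move=> p_sub.
pose T := {q : V -> R | sublinear q /\ forall u, q u <= p u}.
pose below (q r : T) := `[< forall u, sval r u <= sval q u >].
have chain (A : set T) : total_on A below -> exists t, forall s, A s -> below s t.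
  move=> tot; have [A0|/set0P[s0 As0]] := eqVneq A set0.
    by exists (exist _ p (conj p_sub (fun=> lexx _))) => s; rewrite A0.
  pose E u := [set sval s u | s in A]; pose m u := inf (E u).
  have Elb u : has_lbound (E u).
    exists (- p (- u)) => _ [[q [q_sub qp]] Aq <-] /=.
    by have := sublinearN q_sub u; have := qp (- u); lra.
  have mle u s : A s -> m u <= sval s u.
    by move=> As; apply: ge_inf; [exact: Elb|exists s].
  have madh u (e : R) : 0 < e -> exists2 s, A s & sval s u < m u + e.
    move=> e0; have [|_ [s As <-] se] := @inf_adherent _ _ _ e0 (conj _ (Elb u)).
      by exists (sval s0 u), s0.
    by exists s.
  have m_sub : sublinear m.
    apply: sublinearI => [u v||a u a0].
    - apply/ler_addgt0Pr => e e0; have e2 : 0 < e / 2 by lra.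
      have [s As se] := madh u _ e2; have [t At te] := madh v _ e2.
      have [r [Ar rs rt]] : exists r, [/\ A r, sval r u <= sval s u &
          sval r v <= sval t v].
        by have [/asboolP st|/asboolP ts] := tot _ _ As At;
          [exists t|exists s]; split.
      have := mle (u + v) r Ar; have := sublinearD (svalP r).1 u v; lra.
    - by have := mle 0 s0 As0; rewrite (sublinear0 (svalP s0).1).
    - rewrite -ler_pdivrMl//; apply/ler_addgt0Pr => e e0.
      have [s As se] := madh u _ e0; rewrite ler_pdivrMl//.
      apply: (le_trans (mle (a *: u) s As)).
      by rewrite (sublinearZ (svalP s).1 _ (ltW a0)) ler_pM2l// ltW.
  have mp u : m u <= p u by apply: le_trans (mle u s0 As0) _; exact: (svalP s0).2.
  by exists (exist _ m (conj m_sub mp)) => s As; apply/asboolP => u; exact: mle.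
have [||[q [q_sub qp]] qmin] := @ZL_preorder _
  (exist _ p (conj p_sub (fun=> lexx _)) : T) below _ _ chain.
- by move=> t; apply/asboolP.
- move=> r s t /asboolP rs /asboolP st; apply/asboolP => u.
  exact: le_trans (st u) (rs u).
exists q; split=> // r r_sub rq.
have rp u : r u <= p u := le_trans (rq u) (qp u).
have /asboolP/= qr := qmin (exist _ r (conj r_sub rp)) (asboolT rq).
by apply/funext => u; apply/eqP; rewrite eq_le rq qr.
Qed.

(** The Hahn-Banach theorem. A minimal sublinear functional is unchanged when it
    is lowered along a ray [t v], which says that it is superadditive. *)
Theorem linear_minorant p : sublinear p ->
  exists f : {linear V -> R^o}, forall u, f u <= p u.
Proof.
move=> /minimal_sublinear[q [q_sub qp qmin]].
have qD u v : q (u + v) = q u + q v.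
  pose K : set (V * R) := [set (t *: v, t * q v) | t in [set t | 0 <= t]].
  have K0 : K (0, 0) by exists 0; rewrite /= ?scale0r ?mul0r.
  have KD k l : K k -> K l -> K (k.1 + l.1, k.2 + l.2).
    move=> [s s0 <-] [t t0 <-]; exists (s + t); first exact: addr_ge0.
    by rewrite /= scalerDl mulrDl.
  have KZ (a : R) k : 0 < a -> K k -> K (a *: k.1, a * k.2).
    move=> a0 [t t0 <-]; exists (a * t); first by rewrite /= mulr_ge0// ltW.
    by rewrite /= scalerA mulrA.
  have Kq k : K k -> k.2 <= q k.1.
    by move=> [t t0 <-] /=; rewrite (sublinearZ q_sub).
  have Kv : K (v, q v) by exists 1; rewrite /= ?scale1r ?mul1r.
  have le w := lowered_le q_sub Kq w.
  have qE := qmin _ (lowered_sublinear q_sub K0 KD KZ Kq).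
  have {}qE : lowered q K = q.
    by apply: qE => w; have /= := le w _ K0; rewrite addr0 subr0.
  have /= := le u _ Kv; rewrite qE.
  by have := sublinearD q_sub u v; lra.
have q0 := sublinear0 q_sub.
have qN u : q (- u) = - q u by have := qD u (- u); rewrite subrr q0; lra.
have q_lin : linear (q : V -> R^o).
  move=> a u v; rewrite qD; congr (_ + _).
  have [a0|a0] := leP 0 a; first exact: (sublinearZ q_sub).
  have := sublinearZ q_sub u (a := - a); rewrite scaleNr qN.
  by move=> /(_ ltac:(lra)); rewrite mulNr => /oppr_inj.
pose f := HB.pack_for {linear V -> R^o} (q : V -> R^o)
  (GRing.isLinear.Build R V R^o *:%R q q_lin).
by exists f => u; exact: qp.
Qed.

(** The Mazur-Orlicz theorem. It follows from [linear_minorant] for [p] lowered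
    along [K], whose value at [- w] is at most [- c] for [(w, c)] in [K]. *)
Corollary linear_minorant_cone p (K : set (V * R)) : sublinear p ->
  K (0, 0) ->
  (forall k l, K k -> K l -> K (k.1 + l.1, k.2 + l.2)) ->
  (forall (a : R) k, 0 < a -> K k -> K (a *: k.1, a * k.2)) ->
  (forall k, K k -> k.2 <= p k.1) ->
  exists f : {linear V -> R^o},
    (forall u, f u <= p u) /\ forall k, K k -> k.2 <= f k.1.
Proof.
move=> p_sub K0 KD KZ Kp.
have [f fp] := linear_minorant (lowered_sublinear p_sub K0 KD KZ Kp).
exists f; split=> [u|k Kk].
  apply: le_trans (fp u) _.
  by have /= := lowered_le p_sub Kp u K0; rewrite addr0 subr0.
have := le_trans (fp (- k.1)) (lowered_le p_sub Kp _ Kk).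
by rewrite addNr (sublinear0 p_sub) linearN sub0r lerN2.
Qed.

End Sublinear.

(** * Convex combinations *)

Section Conv.
Context {R : realType} {V : normedModType R}.
Implicit Types (A : set V) (x y z u v : V).

(** Terms with coefficient [0] are added, which takes a point of [A]; there is one
    because an empty combination cannot have coefficients of sum [1]. *)
Lemma conv_n_widen A (m n : nat) : (m <= n)%N -> conv_n m A `<=` conv_n n A.
Proof.
case: m => [|m] mn z [a [t [Aa t0 t1 ->]]].
  by move: t1; rewrite big_ord0 => /eqP; rewrite eq_sym oner_eq0.
have sumE (W : nmodType) (G : nat -> W) :
    (forall k, (m < k)%N -> G k = 0) -> \sum_(k < n) G k = \sum_(k < m.+1) G k.
  move=> G0; rewrite -!(big_mkord predT G) (big_cat_nat _ mn)//=.
  rewrite [X in _ + X]big_nat_cond [X in _ + X]big1 ?addr0// => k.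
  by rewrite andbT => /andP[mk _]; exact: G0.
pose s (k : nat) := if (k < m.+1)%N then t (inord k) else 0.
exists (fun k => a (inord k)), (fun k => s k); split=> [k|k||].
- exact: Aa.
- by rewrite /s; case: ifP.
- rewrite sumE => [|k mk]; last by rewrite /s ltnNge mk.
  by rewrite -t1; apply: eq_bigr => k _; rewrite /s ltn_ord inord_val.
- rewrite (sumE _ (fun k => s k *: a (inord k))) => [|k mk].
    by apply: eq_bigr => k _; rewrite /s ltn_ord inord_val.
  by rewrite /s ltnNge mk scale0r.
Qed.

(** Otherwise the differences [f z - f a], which average to [0], would all be
    positive. *)
Lemma conv_n_ge (f : {linear V -> R^o}) A n z : conv_n n A z ->
  exists2 a, A a & f z <= f a.
Proof.
move=> [a [t [Aa t0 t1 ->]]]; apply: contrapT => nA.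
have fa k : f (a k) < f (\sum_k t k *: a k).
  by rewrite ltNge; apply/negP => le; apply: nA; exists (a k).
set z' := \sum_k _ in nA fa.
have /eqP : \sum_k t k * (f z' - f (a k)) = 0.
  under eq_bigr do rewrite mulrBr.
  rewrite sumrB -mulr_suml t1 mul1r /z' linear_sum.
  by apply/eqP; rewrite subr_eq0; apply/eqP/eq_bigr => k _; rewrite linearZ.
rewrite psumr_eq0 => [/allP tf|k _]; last by rewrite mulr_ge0// subr_ge0 ltW.
have : \sum_k t k = 0.
  apply: big1 => k _; have /tf := mem_index_enum k.
  by rewrite implyTb mulf_eq0 subr_eq0 (gt_eqF (fa k)) orbF => /eqP.
by apply/eqP; rewrite t1 oner_eq0.
Qed.

(** Hahn-Banach separation of a point from a convex hull, by
    [linear_minorant_cone] for the norm and for the convex cone that the pairs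
    [(y - a, d)] generate: normalizing the coefficients turns the hypothesis into
    the domination of this cone by the norm. *)
Lemma separation A y (d : R) :
  (forall n z, conv_n n A z -> d <= `|y - z|) ->
  exists f : {linear V -> R^o},
    (forall u, f u <= `|u|) /\ forall a, A a -> d <= f (y - a).
Proof.
move=> yA.
pose K : set (V * R) := [set k | exists (n : nat) (a : 'I_n -> V) (t : 'I_n -> R),
  [/\ forall i, A (a i), forall i, 0 <= t i,
     k.1 = \sum_i t i *: (y - a i) & k.2 = \sum_i t i * d]].
have [||||k [n [a [t [Aa t0 -> ->]]]]|f [fle fK]] :=
  @linear_minorant_cone _ _ (fun u : V => `|u|) K.
- split=> [u v|a u a0]; first exact: ler_normD.
  by rewrite normrZ ger0_norm.
- exists 0, (fun=> y), (fun=> 0); split=> //= [[]//| |]; by rewrite big_ord0.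
- move=> k l [m [a [s [Aa s0 ks ksd]]]] [n [b [t [Ab t0 lt ltd]]]].
  pose glue T (f : 'I_m -> T) (g : 'I_n -> T) i :=
    match fintype.split i with inl j => f j | inr j => g j end.
  exists (m + n)%N, (glue _ a b), (glue _ s t); rewrite /glue.
  have sl j : fintype.split (lshift n j) = inl j by exact: (unsplitK (inl j)).
  have sr j : fintype.split (rshift m j) = inr j by exact: (unsplitK (inr j)).
  split=> [i|i||]; try by case: fintype.split.
  + rewrite big_split_ord ks lt /=; congr (_ + _);
      by apply: eq_bigr => j _; rewrite ?sl ?sr.
  + rewrite big_split_ord ksd ltd /=; congr (_ + _);
      by apply: eq_bigr => j _; rewrite ?sl ?sr.
- move=> c k c0 [n [a [t [Aa t0 kt ktd]]]].
  exists n, a, (fun i => c * t i); split=> [//|i||].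
  + by rewrite mulr_ge0// ltW.
  + by rewrite kt scaler_sumr; apply: eq_bigr => i _; rewrite scalerA.
  + by rewrite ktd mulr_sumr; apply: eq_bigr => i _; rewrite mulrA.
- rewrite -mulr_suml; set s := \sum_i t i.
  have : 0 <= s by exact: sumr_ge0.
  rewrite le_eqVlt => /predU1P[<-|s0]; first by rewrite mul0r.
  pose z := \sum_i (t i / s) *: a i.
  have : d <= `|y - z|.
    apply: (yA n); exists a, (fun i => t i / s); split=> // [i|].
      by rewrite divr_ge0// ltW.
    by rewrite -mulr_suml divff// gt_eqF.
  rewrite -(ler_pM2l s0) => /le_trans; apply.
  rewrite -{1}(gtr0_norm s0) -normrZ /z scalerBr scaler_sumr.
  under eq_bigr do rewrite scalerA mulrCA divff ?gt_eqF// mulr1.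
  under [X in _ <= `|X|]eq_bigr do rewrite scalerBr.
  by rewrite sumrB -scaler_suml.
- exists f; split=> // a Aa.
  have /= := fK (y - a, d); apply; exists 1%N, (fun=> a), (fun=> 1).
  by split=> //=; rewrite big_ord1 ?scale1r ?mul1r.
Qed.

End Conv.

(** * The Daugavet property of a single space *)

Section Opnorm.
Context {R : realType} {X Y : normedModType R}.
Implicit Types (f : X -> Y) (u : X).

Lemma opnorm_ge f u : `|u| <= 1 -> (`|f u|%:E <= opnorm f)%E.
Proof. by move=> u1; apply: ereal_sup_ubound; exists u. Qed.

Lemma opnorm_le f (M : \bar R) :
  (forall u, `|u| <= 1 -> (`|f u|%:E <= M)%E) -> (opnorm f <= M)%E.
Proof. by move=> fM; apply: ge_ereal_sup => _ [u u1 <-]; exact: fM. Qed.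

Lemma opnorm_fin_num f : bounded_fun_norm f -> opnorm f \is a fin_num.
Proof.
move=> /(_ 1)[M fM]; rewrite fin_real//; apply/andP; split.
  have := opnorm_ge f (u := 0); rewrite normr0 => /(_ ler01).
  by apply: lt_le_trans; rewrite ltNyr.
apply: (@le_lt_trans _ _ M%:E); last by rewrite ltry.
by apply: opnorm_le => u /fM; rewrite lee_fin.
Qed.

Lemma opnorm_adherent f (s e : R) : opnorm f = s%:E -> 0 < e ->
  exists2 u, `|u| <= 1 & s - e < `|f u|.
Proof.
move=> fs e0; have : ((s - e)%:E < opnorm f)%E by rewrite fs lte_fin; lra.
by move=> /ereal_sup_gt[_ [u u1 <-]]; rewrite lte_fin; exists u.
Qed.

End Opnorm.

Section DaugavetCriterion.
Context {R : realType} {X : normedModType R}.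
Implicit Types (x y z u v : X).

(** Otherwise a functional [f] separates [y] from [lplus x eps]. Let [s] be its
    norm. The operator [Id + f(.) x] almost attains its norm [1 + s] at some [z] of
    the unit ball with [0 <= f z]. Then [f z] is almost [s], hence almost at least
    [f y], and yet [z] is in [lplus x eps]. *)
Lemma daugavet_conv_lplus : daugavet_property X ->
  forall x y (eps d : R), unit_sphere X x -> unit_sphere X y -> 0 < eps -> 0 < d ->
  exists n z, conv_n n (lplus x eps) z /\ `|y - z| < d.
Proof.
move=> DX x y eps d x1 y1 eps0 d0; apply: contrapT => yfar.
have [n z nz|f [fle fA]] := @separation _ _ (lplus x eps) y d.
  by rewrite leNgt; apply/negP => yz; apply: yfar; exists n, z.
have fabs u : `|f u| <= `|u|.
  by rewrite ler_norml fle andbT lerNl -linearN -(normrN u) fle.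
have fx : d <= f (y - x).
  by apply: fA; split; rewrite ?x1 -?mulr2n ?normrMn ?x1; lra.
pose T0 u := f u *: x.
have T_lin : linear T0.
  by move=> a u v; rewrite /T0 linearP scalerDl scalerA.
pose T := HB.pack_for {linear X -> X} T0
  (GRing.isLinear.Build R X X *:%R T0 T_lin).
have nT u : `|T u| = `|f u| by rewrite /T/= /T0 normrZ x1 mulr1.
have bT : bounded_fun_norm T.
  by move=> r; exists r => u ur; rewrite nT; exact: le_trans (fabs u) ur.
have rT : rank_one T.
  exists x; first by rewrite -normr_eq0 x1 oner_eq0.
  apply/seteqP; split=> [_ [u _ <-]|_ [a _ <-]]; first by exists (f u).
  have fyx : f (y - x) != 0 by rewrite gt_eqF// (lt_le_trans d0).
  exists ((a / f (y - x)) *: (y - x)) => //.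
  by rewrite /T/= /T0 linearZ/=; congr (_ *: _); exact: divfK.
have /fineK/esym := opnorm_fin_num bT; set s := fine _ => Ts.
have fs u : `|u| <= 1 -> `|f u| <= s.
  by move=> u1; have := opnorm_ge T u1; rewrite Ts nT lee_fin.
have s0 : 0 < s.
  have := fs y; have := fs x; rewrite x1 y1 lexx => /(_ isT) + /(_ isT).
  by move: fx; rewrite linearB/= !ler_norml; lra.
have := DX T bT rT; rewrite Ts -EFinD => sT.
pose c := Num.min eps 1; pose e := Num.min d (c * s).
have c0 : 0 < c by rewrite lt_min eps0 ltr01.
have e0 : 0 < e by rewrite lt_min d0 mulr_gt0.
have c_eps : c <= eps by rewrite ge_min lexx.
have c1 : c <= 1 by rewrite ge_min lexx orbT.
have e_d : e <= d by rewrite ge_min lexx.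
have e_s : e <= c * s by rewrite ge_min lexx orbT.
have [z [z1 fz0 ze]] : exists z, [/\ `|z| <= 1, 0 <= f z &
    1 + s - e < `|z + f z *: x|].
  have [z z1 /= ze] := opnorm_adherent sT e0.
  have [fz0|fz0] := leP 0 (f z); first by exists z.
  exists (- z); rewrite normrN linearN/= oppr_ge0; split=> //; first exact: ltW.
  by rewrite scaleNr -opprD normrN.
have fzs : f z <= s by rewrite -(ger0_norm fz0) fs.
have fze : s - e < f z.
  have := lt_le_trans ze (ler_normD _ _).
  by rewrite normrZ x1 mulr1 ger0_norm//; lra.
have fz_gt0 : 0 < f z by apply: le_lt_trans fze; nra.
have zA : lplus x eps z.
  split; first by lra.
  (* [z + f z x] is the convex combination of [x + z] and [z] with weight [f z],
     if [f z <= 1]. *)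
  have fz1 : f z <= 1 by apply: le_trans (fle z) z1.
  have : `|z + f z *: x| <= f z * `|x + z| + (1 - f z).
    have -> : z + f z *: x = f z *: (x + z) + (1 - f z) *: z.
      by rewrite scalerDr scalerBl scale1r addrACA subrr addr0 addrC.
    apply: (le_trans (ler_normD _ _)); rewrite !normrZ ger0_norm// lerD2l.
    by rewrite ger0_norm ?subr_ge0// ler_piMr// subr_ge0.
  have : 0 <= (s - f z) * (1 - c) by rewrite mulr_ge0 ?subr_ge0.
  by rewrite -(ltr_pM2l fz_gt0); nra.
have := fA z zA; have := fs y; rewrite y1 lexx linearB/= => /(_ isT).
by rewrite ler_norml; lra.
Qed.


(** A rank one operator is [f(.) x] with [x] on the sphere and [f] of norm
    [s]. If [f] is almost [s] at a point of the sphere that is close to an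
    average of elements of [lplus x e], it is almost [s] at one of these elements,
    where [Id + f(.) x] then has norm almost [1 + s]. *)
Lemma conv_lplus_daugavet :
  (forall x y (eps d : R), unit_sphere X x -> unit_sphere X y ->
    0 < eps -> 0 < d -> exists n z, conv_n n (lplus x eps) z /\ `|y - z| < d) ->
  daugavet_property X.
Proof.
move=> HX T bT [v v0 rT]; have /fineK/esym := opnorm_fin_num bT.
set s := fine _ => Ts; rewrite Ts -EFinD.
have Tball u : `|u| <= 1 -> `|T u| <= s.
  by move=> u1; have := opnorm_ge T u1; rewrite Ts lee_fin.
have Tle u : `|T u| <= s * `|u|.
  have [->|u0] := eqVneq u 0; first by rewrite linear0 !normr0 mulr0.
  have := Tball (`|u|^-1 *: u); rewrite linearZ/= !normrZ normfV normr_id.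
  rewrite mulVf ?normr_eq0// lexx => /(_ isT).
  by rewrite mulrC ler_pdivrMr// normr_gt0.
have s0 : 0 < s.
  have [u _ Tu] : range T v by rewrite rT; exists 1; rewrite ?scale1r.
  rewrite ltNge; apply/negP => s0; have := Tle u; rewrite Tu leNgt => /negP; apply.
  by apply: le_lt_trans (_ : _ <= 0) _; rewrite ?normr_gt0// mulr_le0_ge0.
pose x := `|v|^-1 *: v.
have x1 : unit_sphere X x.
  by rewrite /unit_sphere/= normrZ normfV normr_id mulVf// normr_eq0.
have x0 : x != 0 by rewrite -normr_eq0 x1 oner_eq0.
have [f Tf] : exists f : {linear X -> R^o}, forall u, T u = f u *: x.
  have /choice[f0 Tf0] u : exists a : R, T u = a *: x.
    have : range T (T u) by exists u.
    rewrite rT => -[a _ <-]; exists (a * `|v|).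
    by rewrite scalerA mulfK// normr_eq0.
  have f_lin : linear (f0 : X -> R^o).
    move=> a u w; apply/eqP; rewrite -subr_eq0; have := linearP T a u w => /=.
    rewrite !Tf0 (scalerA a) -scalerDl => /eqP.
    rewrite -subr_eq0 -scalerBl scaler_eq0.
    by rewrite (negbTE x0) orbF.
  pose f := HB.pack_for {linear X -> R^o} (f0 : X -> R^o)
    (GRing.isLinear.Build R X R^o *:%R f0 f_lin).
  exists f => u; exact: Tf0.
have nT u : `|T u| = `|f u| by rewrite Tf normrZ x1 mulr1.
have fle u : f u <= s * `|u| by apply: le_trans (Tle u); rewrite nT ler_norm.
apply/eqP; rewrite eq_le; apply/andP; split.
  apply: opnorm_le => u u1; rewrite lee_fin; apply: (le_trans (ler_normD _ _)).
  by rewrite lerD// Tball.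
rewrite leNgt; apply/negP => sT.
have : opnorm (fun u => u + T u) \is a fin_num.
  rewrite fin_real//; apply/andP; split; last by apply: lt_trans sT _; rewrite ltry.
  have := opnorm_ge (fun u => u + T u) (u := 0); rewrite normr0 => /(_ ler01).
  by apply: lt_le_trans; rewrite ltNyr.
move=> /fineK/esym; set r := fine _ => rE; rewrite rE lte_fin in sT.
have le_r u : `|u + T u| <= r * `|u|.
  have [->|u0] := eqVneq u 0; first by rewrite linear0 addr0 normr0 mulr0.
  have := opnorm_ge (fun u => u + T u) (u := `|u|^-1 *: u).
  rewrite linearZ/= -scalerDr !normrZ normfV normr_id mulVf ?normr_eq0// lexx.
  by rewrite rE lee_fin mulrC ler_pdivrMr ?normr_gt0// => /(_ isT).
(* The estimates below amount to [1 + s - r < c e]. *)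
pose c := 4 * s + 3; pose e := Num.min (s / 2) ((1 + s - r) / (2 * c)).
have c0 : 0 < c by rewrite /c; lra.
have e0 : 0 < e by rewrite lt_min !divr_gt0//; lra.
have es : e * 2 <= s.
  by rewrite -ler_pdivlMr ?ge_min ?lexx//; lra.
have er : e * (2 * c) <= 1 + s - r.
  by rewrite -ler_pdivlMr ?ge_min ?lexx ?orbT//; lra.
have [y y1 fy] : exists2 y, unit_sphere X y & s - e < f y.
  have [u u1] := opnorm_adherent Ts e0; rewrite nT => fu.
  wlog fu0 : u u1 fu / 0 <= f u.
    move=> wl; have [fu0|/ltW fu0] := leP 0 (f u); first exact: (wl u).
    by apply: (wl (- u)); rewrite ?normrN ?linearN/= ?normrN// oppr_ge0.
  rewrite ger0_norm// in fu.
  have u0 : 0 < `|u|.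
    by rewrite normr_gt0; apply/eqP => u0; move: fu; rewrite u0 linear0; nra.
  exists (`|u|^-1 *: u).
    by rewrite /unit_sphere/= normrZ normfV normr_id mulVf// gt_eqF.
  apply: (lt_le_trans fu); rewrite linearZ/=.
  by rewrite -[leLHS]mul1r; apply: ler_wpM2r => //; rewrite invf_ge1.
have [n [z [zA yz]]] := HX x y e e x1 y1 e0 e0.
have [a [a1 xa] fza] := conv_n_ge f zA.
have fa : s - e - s * e < f a.
  apply: lt_le_trans fza; have := fle (y - z); rewrite linearB/=.
  have : s * `|y - z| < s * e by rewrite ltr_pM2l.
  by lra.
have fa' : f a <= s + s * e by have := fle a; nra.
have xa' : 1 + s - (2 * s + 1) * e < `|a + s *: x|.
  have [s1|s1] := leP s 1.
    have := ler_normB (a + s *: x) (- ((1 - s) *: x)); rewrite opprK.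
    have -> : a + s *: x + (1 - s) *: x = x + a.
      by rewrite -addrA -scalerDl addrC [s + _]addrC subrK scale1r.
    by rewrite normrN normrZ x1 mulr1 ger0_norm; nra.
  have := ler_normB (a + s *: x) (- ((s - 1) *: a)); rewrite opprK.
  have -> : a + s *: x + (s - 1) *: a = s *: (x + a).
    by rewrite scalerDr scalerBl scale1r [a + _]addrC addrACA subrr addr0.
  by rewrite normrN !normrZ !ger0_norm; nra.
have : 1 + s - (3 * s + 2) * e < `|a + T a|.
  have := ler_normB (a + f a *: x) ((f a - s) *: x).
  have -> : a + f a *: x - (f a - s) *: x = a + s *: x.
    by rewrite scalerBl opprB addrACA subrr addr0.
  have : `|f a - s| <= (1 + s) * e by rewrite ler_norml; nra.
  by rewrite normrZ x1 mulr1 -Tf; nra.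
have r0 : 0 <= r by have := le_r x; rewrite x1 mulr1; exact: le_trans.
by have := le_r a; rewrite /c in er; nra.
Qed.

End DaugavetCriterion.

(** * The Daugavet modulus *)

Section Daug.
Context {R : realType} {X : normedModType R}.
Implicit Types (x y z : X) (eps d : R).

Lemma edist_inf_lt (A : set X) y d :
  (edist_inf A y < d%:E)%E <-> exists2 z, A z & `|y - z| < d.
Proof.
split=> [/ereal_inf_lt[_ [z Az <-]] /edist_lt_ball|[z Az yz]].
  by rewrite -ball_normE => yz; exists z.
have : (edist_inf A y <= edist (y, z))%E by apply: ereal_inf_lbound; exists z.
move=> /le_lt_trans; apply.
apply: (@le_lt_trans _ _ ((`|y - z| + d) / 2)%:E); last by rewrite lte_fin; lra.
have := normr_ge0 (y - z) => yz0; apply: edist_fin; first by lra.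
by rewrite -ball_normE /=; lra.
Qed.

Lemma Daug_lt n eps d x y : (Daug n X eps < d%:E)%E ->
  unit_sphere X x -> unit_sphere X y ->
  exists2 z, conv_n n (lplus x eps) z & `|y - z| < d.
Proof.
move=> Dd x1 y1; apply/edist_inf_lt; apply: le_lt_trans Dd.
by apply: ereal_sup_ubound; exists x => //; exists y.
Qed.

Lemma Daug_ge n eps d : 0 < d -> ~ (Daug n X eps < d%:E)%E ->
  exists x y, [/\ unit_sphere X x, unit_sphere X y &
    forall z, conv_n n (lplus x eps) z -> d / 2 <= `|y - z|].
Proof.
move=> d0 /negP; rewrite -leNgt => dD.
have : ((d / 2)%:E < Daug n X eps)%E.
  by apply: lt_le_trans dD; rewrite lte_fin; lra.
move=> /ereal_sup_gt[_ [x x1 [y y1 <-]] dxy]; exists x, y; split=> // z zA.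
rewrite leNgt; apply/negP => yz; move: dxy; apply/negP; rewrite -leNgt ltW//.
by apply/edist_inf_lt; exists z.
Qed.

End Daug.

(** * Ultraproducts *)

Section CountablyIncomplete.
Context {I : Type} {U : set_system I} {FU : UltraFilter U}.

(** The diagonal argument that makes ultraproducts along a countably incomplete
    ultrafilter saturated for countable sets of conditions. With [A] as in the
    definition of countable incompleteness, [N i] is the largest [n] such that
    [P m] and [A m] hold at [i] for all [m <= n]; it exists as soon as [i] is
    outside the intersection of the [A n]. *)
Lemma countably_incomplete_diagonal (P : nat -> set I) :
  countably_incomplete U -> (forall n, U (P n)) ->
  exists N : I -> nat, U [set i | P (N i) i] /\ forall n, U [set i | (n <= N i)%N].
Proof.
move=> [A [UA nA]] UP.
have UC : U (~` \bigcap_n A n).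
  by have [//|] := in_ultra_setVsetC (\bigcap_n A n) FU.
pose E n : set I := [set i | forall m, (m <= n)%N -> P m i /\ A m i].
have UE n : U (E n).
  have UPA k : U (P k `&` A k) by exact: filterI.
  elim: n => [|n IH]; first by apply: filterS (UPA 0%N) => i PA [].
  apply: filterS (filterI IH (UPA n.+1)) => i [Ei PA] m.
  by rewrite leq_eqVlt => /predU1P[->//|]; exact: Ei.
have /choice[N EN] i : exists n,
    E 0%N i /\ (~` \bigcap_n A n) i -> E n i /\ ~ E n.+1 i.
  have [[E0 Ci]|nE] := pselect (E 0%N i /\ (~` \bigcap_n A n) i);
    last by exists 0%N.
  apply: contrapT => nN; apply: Ci => n _.
  suff /(_ n (leqnn n))[] : E n i by [].
  elim: n => // n IH; apply: contrapT => nE; apply: nN.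
  by exists n.
have UN : U (E 0%N `&` ~` \bigcap_n A n) by exact: filterI.
exists N; split=> [|n].
  by apply: filterS UN => i /EN[/(_ (N i) (leqnn _))[]].
apply: filterS (filterI (UE n) UN) => i [En /EN[_ nE]].
rewrite /= leqNgt; apply/negP => Nn; apply: nE => m mN.
by apply: En; exact: leq_trans Nn.
Qed.

End CountablyIncomplete.

Section UltraproductLemmas.
Context {R : realType} {I : Type} (U : set_system I) {FU : UltraFilter U}.
Context {X : I -> completeNormedModType R}.
Local Notation family := (bounded_family X).
Local Notation pi := (@ultraproduct_pi R I U FU X).
Implicit Types (x y : family).

Lemma ultraproduct_norm_cvg x : (fun i => `|x i|) @ U --> `|pi x|.
Proof. by rewrite ultraproduct_norm; exact: family_norm_cvg. Qed.

Lemma ultraproduct_pi0 : pi 0 = 0.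
Proof. by rewrite -(scale0r (0 : family)) ultraproduct_piZ scale0r. Qed.

Lemma ultraproduct_pi_sum n (x : 'I_n -> family) :
  pi (\sum_k x k) = \sum_k pi (x k).
Proof.
elim/big_rec2: _ => [|k q y _ <-]; first exact: ultraproduct_pi0.
by rewrite ultraproduct_piD.
Qed.

Lemma bounded_family_sum n (x : 'I_n -> family) i :
  (\sum_k x k) i = \sum_k x k i.
Proof. by apply: (big_morph (fun y : family => y i)). Qed.

Lemma bounded_family_of (f : forall i, X i) (M : R) :
  (forall i, `|f i| <= M) -> exists x : family, forall i, x i = f i.
Proof.
by move=> fM; exists (BoundedFamily (ex_intro _ M fM)).
Qed.

Lemma ultraproduct_unit_sphere (q : ultraproduct U X) : unit_sphere _ q ->
  exists2 x : family, pi x = q & U [set i | unit_sphere (X i) (x i)].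
Proof.
have [y <-] := ultraproduct_pi_surj q => y1.
have [|x xE] := @bounded_family_of (fun i => `|y i|^-1 *: y i) 1.
  move=> i; rewrite normrZ normfV normr_id.
  by have [->|y0] := eqVneq (`|y i|) 0; rewrite ?mulr0// mulVf.
have yc : (fun i => `|y i|) @ U --> (1 : R).
  by rewrite -y1; exact: ultraproduct_norm_cvg.
have Uy : U [set i | 0 < `|y i|] by apply: (cvgr_gt _ yc).
exists x.
  apply/ultraproduct_piP/cvgr0Pnorm_lt => e e0.
  have yc0 : (fun i => `|y i| - 1) @ U --> (0 : R).
    by rewrite -(subrr 1); apply: cvgB => //; exact: cvg_cst.
  have Ue : U [set i | `| `|y i| - 1| < e] by move/cvgr0Pnorm_lt: yc0; exact.
  apply: filterS (filterI Uy Ue) => i [/= y0]; apply: le_lt_trans.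
  have -> : x i - y i = (`|y i|^-1 - 1) *: y i by rewrite xE scalerBl scale1r.
  rewrite normr_id normrZ -{2}[`|y i|]gtr0_norm// -normrM mulrBl.
  by rewrite mulVf ?gt_eqF// mul1r distrC.
apply: filterS Uy => i /= y0.
by rewrite /unit_sphere/= xE normrZ normfV normr_id mulVf ?gt_eqF.
Qed.

(** The gap between [eps] and [eps'], here and in [lplus_ultraproduct], is there
    because limits along [U] exchange strict and large inequalities. *)
Lemma ultraproduct_lplus x (y : family) (eps eps' : R) : eps < eps' ->
  lplus (pi x) eps (pi y) -> U [set i | lplus (x i) eps' (y i)].
Proof.
move=> ee [y1 xy].
have Uy : U [set i | `|y i| <= 1 + eps'].
  by apply: (cvgr_le _ (@ultraproduct_norm_cvg y)); lra.
rewrite -ultraproduct_piD in xy.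
have Uxy : U [set i | 2 - eps' < `|x i + y i|].
  by apply: (cvgr_gt _ (@ultraproduct_norm_cvg (x + y))); lra.
by apply: filterS (filterI Uy Uxy).
Qed.

Lemma lplus_ultraproduct x (y : family) (eps eps' : R) : eps < eps' ->
  U [set i | lplus (x i) eps (y i)] -> lplus (pi x) eps' (pi y).
Proof.
move=> ee Uxy; split.
  have : `|pi y| <= 1 + eps; last by lra.
  by apply: (cvgr_to_le (@ultraproduct_norm_cvg y)); apply: filterS Uxy => i [].
rewrite -ultraproduct_piD; apply: (@lt_le_trans _ _ (2 - eps)); first by lra.
apply: (cvgr_to_ge (@ultraproduct_norm_cvg (x + y))).
by apply: filterS Uxy => i [_ /ltW].
Qed.

(** Convex combinations of a fixed length pass to the ultraproduct, because their
    coefficients have limits along [U]. *)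
Lemma conv_n_ultraproduct n x (y : family) (eps eps' d d' : R) :
  eps < eps' -> d < d' ->
  U [set i | exists2 z, conv_n n (lplus (x i) eps) z & `|y i - z| < d] ->
  exists2 q, conv_n n (lplus (pi x) eps') q & `|pi y - q| < d'.
Proof.
move=> ee dd Uz.
(* The bounds are required at all [i], so that the chosen points and coefficients
   form bounded families; where no combination is close, [0] is chosen. *)
pose good i (g : ('I_n -> X i) * ('I_n -> R)) :=
  [/\ forall k, `|g.1 k| <= `|1 + eps|, forall k, `|g.2 k| <= 1 &
   (exists2 z, conv_n n (lplus (x i) eps) z & `|y i - z| < d) ->
   [/\ forall k, lplus (x i) eps (g.1 k), forall k, 0 <= g.2 k, \sum_k g.2 k = 1 &
     `|y i - \sum_k g.2 k *: g.1 k| < d]].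
have gex i : exists g, good i g.
  have [[z [a [t [xa t0 t1 zE]]] yz]|nz] := pselect (exists2 z,
      conv_n n (lplus (x i) eps) z & `|y i - z| < d).
    exists (a, t); split=> [k|k|_] /=.
    - by rewrite (le_trans _ (ler_norm _))//; case: (xa k).
    - by rewrite ger0_norm// -t1 (bigD1 k)//= lerDl sumr_ge0.
    - by rewrite -zE.
  by exists (fun=> 0, fun=> 0); split=> // k; rewrite normr0.
pose g i := sval (cid (gex i)).
have gP i : good i (g i) := svalP (cid (gex i)).
have /choice[b bE] k : exists b : family, forall i, b i = (g i).1 k.
  apply: (@bounded_family_of (fun i => (g i).1 k) `|1 + eps|) => i.
  by have [g1 _ _] := gP i.
have /choice[t tc] k : exists t : R, (fun i => (g i).2 k) @ U --> t.
  apply/cvg_ex; apply: (@ultra_bounded_cvg _ _ _ _ _ 1) => i.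
  by have [_ g2 _] := gP i.
have /choice[c cE] k : exists c : family, forall i, c i = (g i).2 k *: (g i).1 k.
  apply: (@bounded_family_of (fun i => (g i).2 k *: (g i).1 k) `|1 + eps|) => i.
  have [g1 g2 _] := gP i; rewrite normrZ -[leRHS]mul1r.
  by apply: ler_pM; rewrite ?g1 ?g2.
have cb k : pi (c k) = t k *: pi (b k).
  rewrite -ultraproduct_piZ; apply/ultraproduct_piP.
  have -> : (fun i => `|c k i - (t k *: b k) i|) =
      (fun i => `|(g i).2 k - t k| * `|b k i|).
    by apply/funext => i; rewrite cE -bE -normrZ scalerBl.
  apply: (@squeeze_cvgr _ _ _ _ (fun=> 0)
    (fun i => `|1 + eps| * `|(g i).2 k - t k|)).
  + apply: nearW => i; rewrite mulr_ge0//= mulrC ler_wpM2r// bE.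
    by have [g1 _ _] := gP i.
  + exact: cvg_cst.
  + rewrite -(mulr0 `|1 + eps|); apply: cvgMl_tmp.
    rewrite -(normr0 R) -(subrr (t k)).
    by apply: cvg_norm; apply: cvgB; [exact: tc|exact: cvg_cst].
exists (\sum_k t k *: pi (b k)).
  exists (fun k => pi (b k)), t; split=> // [k|k|].
  - apply: (lplus_ultraproduct ee); apply: filterS Uz => i zi.
    by have [_ _ /(_ zi)[gl _ _ _]] := gP i; rewrite /= bE.
  - apply: (cvgr_to_ge (tc k)); apply: filterS Uz => i zi.
    by have [_ _ /(_ zi)[_ g0 _ _]] := gP i.
  - have sc : (fun i => \sum_k (g i).2 k) @ U --> \sum_k t k.
      by apply: cvg_big => //; exact: add_continuous.
    have s1 : (fun i => \sum_k (g i).2 k) @ U --> (1 : R).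
      apply: cvg_near_cst; apply: filterS Uz => i zi.
      by have [_ _ /(_ zi)[_ _ g1 _]] := gP i.
    exact: cvg_unique sc s1.
have -> : \sum_k t k *: pi (b k) = pi (\sum_k c k).
  by rewrite ultraproduct_pi_sum; apply: eq_bigr => k _; rewrite cb.
have <- : pi (y - \sum_k c k) = pi y - pi (\sum_k c k).
  by rewrite -scaleN1r ultraproduct_piD ultraproduct_piZ scaleN1r.
apply: le_lt_trans dd; apply: (cvgr_to_le (@ultraproduct_norm_cvg _)).
apply: filterS Uz => i zi; have [_ _ /(_ zi)[_ _ _ /ltW]] := gP i.
apply: le_trans; rewrite le_eqVlt; apply/orP; left; apply/eqP.
congr (`|_|); congr (_ - _).
by rewrite bounded_family_sum; apply: eq_bigr => k _; rewrite cE.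
Qed.

End UltraproductLemmas.

(** * The Daugavet property of an ultraproduct *)

Section DaugavetUltraproduct.
Context {R : realType} {I : Type} {U : set_system I} {FU : UltraFilter U}.
Context {X : I -> completeNormedModType R}.

(** If no [n] works, the length [N i] of the combinations that fail to approach
    [y i] exceeds any given [n] for [U]-many [i]. *)
Lemma daugavet_ultraproduct_Daug (eps d : R) : countably_incomplete U ->
  daugavet_property (ultraproduct U X) -> 0 < eps -> 0 < d ->
  exists n, U [set i | (Daug n (X i) eps < d%:E)%E].
Proof.
move=> CIU DX eps0 d0; apply: contrapT => nD.
pose bad n : set I := [set i | ~ (Daug n (X i) eps < d%:E)%E].
have UB n : U (bad n).
  have [Dn|//] := in_ultra_setVsetC [set i | (Daug n (X i) eps < d%:E)%E] FU.
  by exfalso; apply: nD; exists n.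
have [N [UBN UN]] := countably_incomplete_diagonal CIU UB.
pose far i (g : X i * X i) := [/\ `|g.1| <= 1, `|g.2| <= 1 & bad (N i) i ->
  [/\ unit_sphere (X i) g.1, unit_sphere (X i) g.2 &
    forall z, conv_n (N i) (lplus g.1 eps) z -> d / 2 <= `|g.2 - z|]].
have fex i : exists g, far i g.
  have [bi|nb] := pselect (bad (N i) i).
    have [x [y [x1 y1 xy]]] := Daug_ge d0 bi.
    by exists (x, y); split; rewrite /= ?x1 ?y1.
  by exists (0, 0); split; rewrite //= normr0.
pose g i := sval (cid (fex i)).
have gP i : far i (g i) := svalP (cid (fex i)).
have [|x xE] := @bounded_family_of _ _ X (fun i => (g i).1) 1.
  by move=> i; have [] := gP i.
have [|y yE] := @bounded_family_of _ _ X (fun i => (g i).2) 1.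
  by move=> i; have [] := gP i.
have sphere (z : bounded_family X) : U [set i | `|z i| = 1] ->
    unit_sphere (ultraproduct U X) (ultraproduct_pi U z).
  move=> z1; apply: (cvg_unique _ (@ultraproduct_norm_cvg _ _ _ _ _ z)).
    exact: Rhausdorff.
  exact: cvg_near_cst.
have x1 : unit_sphere (ultraproduct U X) (ultraproduct_pi U x).
  apply: sphere; apply: filterS UBN => i bi.
  by have [_ _ /(_ bi)[]] := gP i; rewrite /= xE.
have y1 : unit_sphere (ultraproduct U X) (ultraproduct_pi U y).
  apply: sphere; apply: filterS UBN => i bi.
  by have [_ _ /(_ bi)[]] := gP i; rewrite /= yE.
have eps2 : 0 < eps / 2 by lra.
have d2 : 0 < d / 2 by lra.
have [n [_ [[a [t [xa t0 t1 ->]]] yz]]] := daugavet_conv_lplus DX x1 y1 eps2 d2.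
have /choice[b ba] k := ultraproduct_pi_surj (a k).
have Ub : U [set i | forall k, lplus (x i) eps (b k i)].
  apply: filter_forall => k; apply: (@ultraproduct_lplus _ _ _ _ _ _ _ (eps / 2)).
    by lra.
  by rewrite ba.
have Uy : U [set i | `|y i - \sum_k t k *: b k i| < d / 2].
  have bE : ultraproduct_pi U (y - \sum_k t k *: b k) =
      ultraproduct_pi U y - \sum_k t k *: a k.
    rewrite -scaleN1r ultraproduct_piD ultraproduct_piZ scaleN1r.
    rewrite ultraproduct_pi_sum; congr (_ - _); apply: eq_bigr => k _.
    by rewrite ultraproduct_piZ ba.
  rewrite -bE in yz.
  have yc := @ultraproduct_norm_cvg _ _ _ FU _ (y - \sum_k t k *: b k).
  have Uyc : \forall i \near U, `|(y - \sum_k t k *: b k) i| < d / 2.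
    exact: (cvgr_lt _ yc).
  apply: filterS Uyc => i /=; apply: le_lt_trans.
  rewrite le_eqVlt; apply/orP; left; apply/eqP; congr (`|_|); congr (_ - _).
  by rewrite bounded_family_sum.
have /filter_ex[i [[/= bi nN] [xb yb]]] :
    U ([set i | bad (N i) i] `&` [set i | (n <= N i)%N] `&`
      ([set i | forall k, lplus (x i) eps (b k i)] `&`
       [set i | `|y i - \sum_k t k *: b k i| < d / 2])).
  by do !apply: filterI.
have [_ _ /(_ bi)[_ _ /(_ (\sum_k t k *: b k i))]] := gP i.
rewrite leNgt -yE => /(_ _)/negP[]; last exact: yb.
apply: (conv_n_widen nN); exists (fun k => b k i), t; split=> // k.
by rewrite -xE.
Qed.

Lemma Daug_daugavet_ultraproduct :
  (forall eps : R, 0 < eps -> forall d : R, 0 < d ->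
    exists n, U [set i | (Daug n (X i) eps < d%:E)%E]) ->
  daugavet_property (ultraproduct U X).
Proof.
move=> HD; apply: conv_lplus_daugavet => p q eps d.
move=> /ultraproduct_unit_sphere[x <- Ux] /ultraproduct_unit_sphere[y <- Uy].
move=> eps0 d0.
have eps2 : 0 < eps / 2 by lra.
have d2 : 0 < d / 2 by lra.
have [n UD] := HD _ eps2 _ d2.
have [||| r rn yr] := @conv_n_ultraproduct _ _ U _ X n x y (eps / 2) eps (d / 2) d.
- by lra.
- by lra.
- apply: filterS (filterI UD (filterI Ux Uy)) => i [Di [x1 y1]].
  exact: Daug_lt Di x1 y1.
- by exists n, r.
Qed.

End DaugavetUltraproduct.

Theorem theorem6p2 (R : realType) (I : Type) (U : set_system I)
    (FU : UltraFilter U) (CIU : countably_incomplete U)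
    (X : I -> completeNormedModType R) :
  daugavet_property (ultraproduct U X) <->
  (forall eps : R, 0 < eps -> forall delta : R, 0 < delta ->
     exists n : nat, U [set i | (Daug n (X i) eps < delta%:E)%E]).
Proof.
split=> [DX eps eps0 d d0|]; last exact: Daug_daugavet_ultraproduct.
exact: daugavet_ultraproduct_Daug.
Qed.
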